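(* If $|\Delta(\mathfrak{m})|=1$, the centralizer $c_{\mathfrak{u}}(x(d))$ is characterized as follows: (1) If $\Delta(\mathfrak{m})=\{\alpha_1\}$, then the elements $e_{2,n+1},\ x(d)^k\ (1\le k\le n-1)$ form a basis of $c_{\mathfrak{u}}(x(d))$. (2) If $\Delta(\mathfrak{m})=\{\alpha_s\}$ with $1<s<n$, then the elements $e_{1,s+1},\ e_{s+1,n+1},\ x(d)^k\ (1\le k\le n-1)$ form a basis of $c_{\mathfrak{u}}(x(d))$. (3) If $\Delta(\mathfrak{m})=\{\alpha_n\}$, then the elements $e_{1,n+1},\ x(d)^k\ (1\le k\le n-1)$ form a basis of $c_{\mathfrak{u}}(x(d))$.
   Context: $K$ is an algebraically closed field of characteristic $p>0$. A dimension vector is a tuple $d=(d_1,\ldots,d_\ell)$ of positive integers with $\sum_i d_i=n+1$. $\mathfrak{p}(d)=\mathfrak{m}\oplus\mathfrak{u}\subseteq\mathfrak{sl}_{n+1}(K)$ is the standard (block upper-triangular) parabolic subalgebra with diagonal block sizes $d_1,\ldots,d_\ell$, Levi factor $\mathfrak{m}$ and nilradical $\mathfrak{u}$. $\Delta=\{\alpha_1,\ldots,\alpha_n\}$, $\alpha_i=\epsilon_i-\epsilon_{i+1}$, is the set of simple roots and $\Delta(\mathfrak{m})\subseteq\Delta$ is the set of simple roots of $\mathfrak{m}$ ($\alpha_i\in\Delta(\mathfrak{m})$ iff $i,i+1$ lie in the same block). Horizontal line diagram $L_h(d)$: arrange $\ell$ columns of $d_1,\ldots,d_\ell$ dots, top-adjusted;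 label the dots $1,\ldots,n+1$ column by column from left to right, top to bottom in each column; join each dot by a horizontal line to the next dot to its right in the same row, if there is one (possibly skipping columns having no dot in that row). The Richardson element is $x(d)=\sum e_{i,j}$ (matrix units), summed over all horizontal lines $i - j$ of $L_h(d)$ with $i<j$. $c_{\mathfrak{u}}(x(d))=\{z\in\mathfrak{u}\mid [z,x(d)]=0\}$, and $x(d)^k$ denotes the matrix power.
   Formalization: The formal theorem assumes n ≥ 2; for n = 1 the dimension vector is d = (2), so u = 0 and claims (1) and (3) fail, since they would make e_{2,2} and e_{1,2} bases of the zero space. *)

(* Defs.v *)
From mathcomp Require Import all_boot all_order all_algebra.
From mathcomp Require Import finmap.

Set Implicit Arguments.
Unset Strict Implicit.
Unset Printing Implicit Defensive.

Import GRing.Theory.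
Local Open Scope ring_scope.

Definition dim_vector (n : nat) (d : seq nat) : bool :=
  all (fun k => 0 < k)%N d && (sumn d == n.+1).

(* The mathematical labels 1, ..., n+1 are represented by the ordinals
   0, ..., n; [label n k] is the ordinal of the 1-based label k and is only
   meaningful for 1 <= k <= n+1 (inord sends larger values to 0). *)
Definition label (n k : nat) : 'I_n.+1 := inord k.-1.

(* e_{i,j}, with the 1-based indices of the literature. *)
Definition munit (K : closedFieldType) (n i j : nat) : 'M[K]_n.+1 :=
  delta_mx (label n i) (label n j).

(* Column (= diagonal block) and row of a dot of the top-adjusted diagram with
   columns of heights d_1, ..., d_l, the dots being numbered column by column.
   Here dots, columns and rows are counted from 0. *)
Definition dot_col (d : seq nat) (i : nat) : nat := reshape_index d i.
Definition dot_row (d : seq nat) (i : nat) : nat := reshape_offset d i.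

(* Dot j is the next dot to the right of dot i in its row: the columns strictly
   in between are too short to reach that row. *)
Definition hline (d : seq nat) (i j : nat) : bool :=
  [&& dot_row d i == dot_row d j, (dot_col d i < dot_col d j)%N &
      all (fun c => nth 0 d c <= dot_row d i)%N
          (index_iota (dot_col d i).+1 (dot_col d j))].

Definition richardson (K : closedFieldType) (n : nat) (d : seq nat) :
    'M[K]_n.+1 :=
  \sum_(i < n.+1) \sum_(j < n.+1 | hline d i j) delta_mx i j.

(* alpha_s = epsilon_s - epsilon_{s+1} for 1 <= s <= n, as a vector of Z^{n+1}. *)
Definition simple_root (n s : nat) : 'rV[int]_n.+1 :=
  delta_mx 0 (label n s) - delta_mx 0 (label n s.+1).

(* Delta(m): alpha_s such that the labels s and s+1 lie in the same block. *)
Definition levi_simple_roots (n : nat) (d : seq nat) : {fset 'rV[int]_n.+1} :=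
  [fset simple_root n s | s in iota 1 n &
     dot_col d (label n s) == dot_col d (label n s.+1)]%fset.

(* The nilradical u of p(d): strictly block upper-triangular matrices. *)
Definition nilradical (K : closedFieldType) (n : nat) (d : seq nat) :
    {vspace 'M[K]_n.+1} :=
  <<[seq delta_mx ij.1 ij.2 | ij in [pred ij : 'I_n.+1 * 'I_n.+1 |
       (dot_col d ij.1 < dot_col d ij.2)%N]]>>%VS.

Definition lie_bracket (K : closedFieldType) (n : nat) (x z : 'M[K]_n.+1) :
    'M[K]_n.+1 :=
  z *m x - x *m z.

(* {z in U | [z, x] = 0}, see mem_lie_centralizer. *)
Definition lie_centralizer (K : closedFieldType) (n : nat)
    (U : {vspace 'M[K]_n.+1}) (x : 'M[K]_n.+1) : {vspace 'M[K]_n.+1} :=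
  (U :&: lker (linfun (lie_bracket x)))%VS.

Lemma mem_nilradical (K : closedFieldType) (n : nat) (d : seq nat)
    (z : 'M[K]_n.+1) :
  z \in nilradical K n d <->
  (forall i j : 'I_n.+1, (dot_col d j <= dot_col d i)%N -> z i j = 0).
Proof.
split=> [|z0].
  rewrite /nilradical => zU i j ji.
  rewrite (coord_span (X := in_tuple _) zU) summxE big1 // => k _.
  rewrite mxE.
  have /imageP [[a b] /= ab ->] := mem_nth 0 (ltn_ord k).
  rewrite mxE; case: eqP => [ia|_]; last by rewrite mulr0.
  case: eqP => [jb|_]; last by rewrite mulr0.
  by move: ab; rewrite inE /= -ia -jb ltnNge ji.
rewrite (matrix_sum_delta z); apply: memv_suml => i _; apply: memv_suml => j _.
case: (leqP (dot_col d j) (dot_col d i)) => [/z0 ->|ij].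
  by rewrite scale0r mem0v.
apply/memvZ/memv_span/imageP; by exists (i, j).
Qed.

Lemma mem_lie_centralizer (K : closedFieldType) (n : nat)
    (U : {vspace 'M[K]_n.+1}) (x z : 'M[K]_n.+1) :
  z \in lie_centralizer U x <-> z \in U /\ lie_bracket x z = 0.
Proof.
rewrite /lie_centralizer memv_cap memv_ker.
have -> : linfun (lie_bracket x) z = lie_bracket x z.
  exact: (lfunE (mulmxr x \- mulmx x)).
by split=> [/andP[zU /eqP]|[-> ->]] //; rewrite eqxx.
Qed.

(* Main.v *)
Require Import Defs.
From mathcomp Require Import all_boot all_order all_algebra.
From mathcomp Require Import finmap.
From mathcomp Require Import zify.

Set Implicit Arguments.
Unset Strict Implicit.
Unset Printing Implicit Defensive.

Import GRing.Theory.
Local Open Scope ring_scope.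

(** If alpha_s is the only simple root of the Levi factor, then d consists of
ones and a single 2, so the diagram has a first row of n dots and a second row
with the single dot h := s + 1.  Hence x = x(d) is one nilpotent Jordan block of
size n on the coordinates other than h, and zero on the coordinate h
([richardson_chain]).  In this file h is written 0-based, i.e. as the ordinal of
value s, and the dots of the first row are [lift h a] for [a : 'I_n].

Commuting with x says that z moves along the chain: row a of x z is row a + 1
of z, and column b + 1 of z x is column b of z.  So the row of z at the
beginning of the chain determines all rows of z except row h, and row h of z
vanishes except at h itself and at the end of the chain
([commute_chain_shift_eq0]).  For z in the nilradical only the following entries
remain free: n - 1 entries of the first row at chain positions 1, ..., n - 1;
the entry (first, h), which is available if and only if h is not in the first
column of the diagram, i.e. 1 < s; and the entry (h, last), which is available
if and only if h is not in the last column, i.e. s < n.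

The powers x ^ k for 0 < k < n, and the matrix units at those of the last two
positions that are available, lie in the centralizer and are dual to these
entries.  Duality gives freeness; together with the fact that z is determined
by its free entries it gives that they span ([basis_of_pivots],
[centralizer_basis]).  The three cases of the theorem differ only in which of
the two matrix units are available. *)

(** * Columns and rows of the dots *)

Lemma dot_col_cons (a : nat) (d : seq nat) (i : nat) :
  dot_col (a :: d) i = if (i < a)%N then 0%N else (dot_col d (i - a)).+1.
Proof.
rewrite /dot_col /reshape_index /= subn_eq0.
by case: ltnP => // ai; rewrite subSn.
Qed.

Lemma dot_row_cons (a : nat) (d : seq nat) (i : nat) :
  dot_row (a :: d) i = if (i < a)%N then i else dot_row d (i - a).
Proof.
rewrite /dot_row /reshape_offset -![reshape_index _ _]/(dot_col _ _).
by rewrite dot_col_cons; case: ltnP => _ /=; rewrite ?subn0 ?subnDA.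
Qed.

Lemma dot0 (d : seq nat) : all (fun k => 0 < k)%N d ->
  dot_col d 0 = 0%N /\ dot_row d 0 = 0%N.
Proof.
by case: d => [|a d] //= /andP[a0 _]; rewrite dot_col_cons dot_row_cons a0.
Qed.

(** Reading the dots column by column, the next dot either stays in its column,
one row below, or starts the next column; no column is skipped because all
heights are positive. *)
Lemma dot_next (d : seq nat) (k : nat) :
    all (fun k => 0 < k)%N d -> (k.+1 < sumn d)%N ->
  (dot_col d k.+1, dot_row d k.+1) \in
    [:: (dot_col d k, (dot_row d k).+1); ((dot_col d k).+1, 0%N)].
Proof.
elim: d k => //= a d IHd k /andP[a0 d0] kd.
rewrite !dot_col_cons !dot_row_cons.
case: (ltngtP k.+1 a) => [ka|ak|ka].
- by rewrite !inE eqxx.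
- rewrite subSn //.
  have := IHd (k - a)%N d0.
  rewrite -subSn // ltn_subLR ?kd; last exact: ltnW.
  move=> /(_ isT).
  by rewrite !inE !xpair_eqE !eqSS.
- by rewrite -ka subnn; case: (dot0 d0) => -> ->; rewrite !inE eqxx orbT.
Qed.

(** If s - 1 and s are the only consecutive dots in a common column, every other
step of the reading order opens a new column, so that columns lag behind dots by
one from s on, and s is the only dot that is not at the top. *)
Lemma dot_single_pair (d : seq nat) (s : nat) :
    all (fun k => 0 < k)%N d -> (0 < s)%N ->
    (forall k, (k.+1 < sumn d)%N ->
       (dot_col d k == dot_col d k.+1) = (k.+1 == s)) ->
  forall k, (k < sumn d)%N ->
    dot_col d k = (k - (s <= k))%N /\ dot_row d k = (k == s).
Proof.
move=> d0 s0 pair; elim=> [|k IHk] kd.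
  by have [-> ->] := dot0 d0; rewrite eq_sym -leqn0 leqNgt s0.
have [ck rk] := IHk (ltnW kd).
have := pair _ kd; have := dot_next d0 kd.
rewrite !inE !xpair_eqE => /orP[] /andP[/eqP -> /eqP ->]; rewrite ck ?rk.
  rewrite eqxx => /esym/eqP <-.
  by rewrite leqnn ltnn eqxx ltn_eqF // subn0 subn1.
by rewrite ltn_eqF // => /esym ks; split; lia.
Qed.

(** * The diagram of a Levi factor with one simple root *)

Lemma simple_root_inj (n s t : nat) : (0 < s <= n)%N -> (0 < t <= n)%N ->
  simple_root n s = simple_root n t -> s = t.
Proof.
case: s t => [|s] [|t] //= sn tn /rowP/(_ (label n s.+1)).
rewrite !mxE !eqxx /= -!val_eqE /= !inordK ?ltnS // 1?ltnW //.
rewrite ltn_eqF // subr0 eq_sym.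
by rewrite /=; case: eqP => [-> //|_]; case: eqP.
Qed.

(** The set of roots determines which consecutive dots share a block because
distinct indices give distinct simple roots. *)
Lemma levi_pair (n s : nat) (d : seq nat) : (0 < s <= n)%N ->
    levi_simple_roots n d = [fset simple_root n s]%fset ->
  forall k, (k < n)%N -> (dot_col d k == dot_col d k.+1) = (k.+1 == s).
Proof.
move=> sn levi k kn.
have vlabel t : (t <= n)%N -> label n t.+1 = t :> nat.
  by move=> tn; rewrite inordK.
apply/idP/eqP => [ck|ks].
  apply: (@simple_root_inj n) => //.
  apply/eqP; rewrite -in_fset1 -levi; apply/imfsetP; exists k.+1 => //=.
  by rewrite inE mem_iota /= add1n ltnS kn !vlabel ?(ltnW kn).
have : simple_root n s \in levi_simple_roots n d by rewrite levi in_fset1.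
case/imfsetP => t /=; rewrite inE mem_iota add1n ltnS => /andP[tn ct] st.
move: ct; rewrite -(simple_root_inj sn tn st) -ks.
by rewrite !vlabel // ltnW.
Qed.

Lemma dot_lift (n : nat) (d : seq nat) (h : 'I_n.+1) :
    dim_vector n d -> (0 < h)%N ->
    levi_simple_roots n d = [fset simple_root n h]%fset ->
  [/\ dot_col d h = h.-1, dot_row d h = 1%N,
      forall a : 'I_n, dot_col d (lift h a) = a &
      forall a : 'I_n, dot_row d (lift h a) = 0%N].
Proof.
case/andP=> d0 /eqP sd h0 levi.
have hn : (0 < h <= n)%N by rewrite h0 -ltnS ltn_ord.
have dot k : (k < n.+1)%N ->
    dot_col d k = (k - (h <= k))%N /\ dot_row d k = (k == h).
  move=> kn; apply: dot_single_pair => // [k0|]; rewrite sd ?ltnS //.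
  exact: levi_pair.
have [ch rh] := dot h (ltn_ord h).
split; first by rewrite ch leqnn subn1.
- by rewrite rh eqxx.
- move=> a; have [-> _] := dot _ (ltn_ord (lift h a)).
  by rewrite /= /bump; case: (leqP h a) => ha; lia.
- move=> a; have [_ ->] := dot _ (ltn_ord (lift h a)).
  by rewrite eq_sym val_eqE (negPf (neq_lift h a)).
Qed.

Lemma lift_ord0 (n : nat) (h : 'I_n.+1) (a : 'I_n) :
  (0 < h)%N -> a = 0%N :> nat -> lift h a = ord0.
Proof. by move=> h0 a0; apply: val_inj; rewrite /= a0 /bump leqNgt h0. Qed.

(** * The shift along a chain of coordinates that avoids one index *)

(** The k-th power of a nilpotent Jordan block on the coordinates other than h,
extended by zero.  For k = 0 this is the projection that kills h, not the
identity. *)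
Definition chain_shift (K : fieldType) (n : nat) (h : 'I_n.+1) (k : nat) :
    'M[K]_n.+1 :=
  \matrix_(i, j) if unlift h i is Some a then
                   if unlift h j is Some b then (b == a + k :> nat)%N%:R else 0
                 else 0.

Lemma chain_shiftE (K : fieldType) (n : nat) (h : 'I_n.+1) (k : nat)
    (a b : 'I_n) :
  chain_shift K h k (lift h a) (lift h b) = (b == a + k :> nat)%N%:R.
Proof. by rewrite mxE !liftK. Qed.

Lemma chain_shift_row (K : fieldType) (n : nat) (h : 'I_n.+1) (k : nat) j :
  chain_shift K h k h j = 0.
Proof. by rewrite mxE unlift_none. Qed.

Lemma chain_shift_col (K : fieldType) (n : nat) (h : 'I_n.+1) (k : nat) i :
  chain_shift K h k i h = 0.
Proof. by rewrite mxE unlift_none; case: unlift. Qed.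

Lemma mul_chain_shift (K : fieldType) (n : nat) (h : 'I_n.+1) (z : 'M[K]_n.+1)
    (i : 'I_n.+1) (a b : 'I_n) : b = a.+1 :> nat ->
  (z *m chain_shift K h 1) i (lift h b) = z i (lift h a).
Proof.
move=> ba; rewrite mxE (bigD1 (lift h a)) //= chain_shiftE addn1 ba eqxx mulr1.
rewrite big1 ?addr0 // => c; case: (unliftP h c) => [c'|] -> ca.
  rewrite chain_shiftE addn1 ba eqSS val_eqE eq_sym.
  by move: ca; rewrite (inj_eq lift_inj) => /negPf ->; rewrite mulr0.
by rewrite chain_shift_row mulr0.
Qed.

Lemma chain_shift_mul (K : fieldType) (n : nat) (h : 'I_n.+1) (z : 'M[K]_n.+1)
    (j : 'I_n.+1) (a b : 'I_n) : b = a.+1 :> nat ->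
  (chain_shift K h 1 *m z) (lift h a) j = z (lift h b) j.
Proof.
move=> ba; rewrite mxE (bigD1 (lift h b)) //= chain_shiftE addn1 ba eqxx mul1r.
rewrite big1 ?addr0 // => c; case: (unliftP h c) => [c'|] -> cb.
  rewrite chain_shiftE addn1 -ba val_eqE.
  by move: cb; rewrite (inj_eq lift_inj) => /negPf ->; rewrite mul0r.
by rewrite chain_shift_col mul0r.
Qed.

Lemma chain_shiftS (K : fieldType) (n : nat) (h : 'I_n.+1) (k : nat) :
  chain_shift K h 1 *m chain_shift K h k = chain_shift K h k.+1.
Proof.
apply/matrixP=> i j.
case: (unliftP h i) => [a|] ->; last first.
  by rewrite chain_shift_row mxE big1 // => c _; rewrite chain_shift_row mul0r.
case: (ltnP a.+1 n) => an.
  rewrite (chain_shift_mul h _ _ (b := Ordinal an)) //.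
  case: (unliftP h j) => [b|] ->; last by rewrite !chain_shift_col.
  by rewrite !chain_shiftE addSnnS.
(* Here a is the end of the chain, and nothing lies beyond it. *)
have out (c : 'I_n) m : (c == a + m.+1 :> nat)%N = false.
  by case: eqP => //; have := ltn_ord c; lia.
rewrite mxE big1 => [|c _].
  case: (unliftP h j) => [b|] ->; last by rewrite chain_shift_col.
  by rewrite chain_shiftE out.
case: (unliftP h c) => [b|] ->; last by rewrite chain_shift_col mul0r.
by rewrite chain_shiftE out mul0r.
Qed.

Lemma chain_shiftX (K : fieldType) (n : nat) (h : 'I_n.+1) (k : nat) :
  (0 < k)%N -> chain_shift K h 1 ^+ k = chain_shift K h k.
Proof.
case: k => // k _; elim: k => [|k IHk]; first by rewrite expr1.
by rewrite exprS IHk [LHS]chain_shiftS.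
Qed.

(** Row b + 1 of z is row b of x z = z x, which vanishes if row b of z does; so
zero rows propagate from the beginning of the chain to its end.  In row h, the
entry b of z is the entry b + 1 of z x = x z, whose row h is zero; only the end
of the chain and h itself escape this. *)
Lemma commute_chain_shift_eq0 (K : fieldType) (n : nat) (h : 'I_n.+1)
    (z : 'M[K]_n.+1) :
    z *m chain_shift K h 1 = chain_shift K h 1 *m z ->
    (forall (a : 'I_n) j, a = 0%N :> nat -> z (lift h a) j = 0) ->
    (forall a : 'I_n, a.+1 = n -> z h (lift h a) = 0) ->
    z h h = 0 ->
  z = 0.
Proof.
move=> zx first last diag.
have row0 k (a : 'I_n) j : a = k :> nat -> z (lift h a) j = 0.
  elim: k a j => [|k IHk] a j ak; first exact: first.
  have kn : (k < n)%N by rewrite -ltnS -ak ltnW // ltnS ltn_ord.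
  rewrite -(chain_shift_mul h z j (a := Ordinal kn)) // -zx mxE.
  by rewrite big1 // => c _; rewrite IHk ?mul0r.
apply/matrixP=> i j; rewrite mxE; case: (unliftP h i) => [a|] ->.
  exact: row0.
case: (unliftP h j) => [b|] -> //.
case: (ltnP b.+1 n) => bn; last first.
  by apply: last; apply/eqP; rewrite eqn_leq bn ltn_ord.
rewrite -(mul_chain_shift h z h (b := Ordinal bn)) // zx mxE big1 // => c _.
by rewrite chain_shift_row mul0r.
Qed.

(** * Bases from dual entries *)

(** Subtracting from z in U the combination of the [f t] whose coefficients are
the entries of z at the positions [g t] leaves an element of U that vanishes at
all these positions, hence zero: the [f t] span U.  Reading a linear relation
at the same positions gives freeness. *)
Lemma basis_of_pivots (K : fieldType) (m n : nat) (U : {vspace 'M[K]_(m, n)})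
    (T : eqType) (r : seq T) (f : T -> 'M[K]_(m, n)) (g : T -> 'I_m * 'I_n) :
    uniq r -> {in r, forall t, f t \in U} ->
    {in r &, forall t u, f t (g u).1 (g u).2 = (t == u)%:R} ->
    (forall z, z \in U -> {in r, forall t, z (g t).1 (g t).2 = 0} -> z = 0) ->
  basis_of U (map f r).
Proof.
move=> r_uniq fU dual sep; apply/andP; split.
  rewrite eqEsubv; apply/andP; split.
    by apply/span_subvP => _ /mapP[t tr ->]; apply: fU.
  apply/subvP => z zU.
  set y := \sum_(t <- r) z (g t).1 (g t).2 *: f t.
  have y_span (V : {vspace 'M[K]_(m, n)}) :
      {in r, forall t, f t \in V} -> y \in V.
    by move=> fV; rewrite /y big_seq; apply: memv_suml => t /fV; apply: memvZ.
  suff -> : z = y by apply: y_span => t tr; apply/memv_span/map_f.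
  apply/subr0_eq/sep => [|t tr]; first by rewrite memvB ?y_span.
  rewrite !mxE /y summxE (bigD1_seq t) //= big_seq_cond.
  rewrite big1 => [|u /andP[ur ut]].
    by rewrite mxE dual // eqxx mulr1 addr0 subrr.
  by rewrite mxE dual // (negPf ut) mulr0.
case: r => [|t0 r] in r_uniq fU dual sep *; first exact: nil_free.
set X := map f _; rewrite -[X]/(val (in_tuple X)); apply/freeP => c c0 i.
have lt_r (j : 'I_(size X)) : (j < size (t0 :: r))%N.
  by rewrite -(size_map f) ltn_ord.
have nth_X (j : 'I_(size X)) : X`_j = f (nth t0 (t0 :: r) j).
  exact: nth_map.
have nth_r (j : 'I_(size X)) : nth t0 (t0 :: r) j \in t0 :: r.
  exact: mem_nth.
set u := g (nth t0 (t0 :: r) i).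
have := congr1 (fun A : 'M_(m, n) => A u.1 u.2) c0.
rewrite summxE (bigD1 i) //= big1 => [|j ji].
  by rewrite !mxE nth_X dual // eqxx mulr1 addr0.
by rewrite mxE nth_X dual // nth_uniq // val_eqE (negPf ji) mulr0.
Qed.

(** * The centralizer of the Richardson element *)

Lemma delta_centralizes (K : fieldType) (n : nat) (x : 'M[K]_n) (i j : 'I_n) :
    (forall b, x j b = 0) -> (forall a, x a i = 0) ->
  delta_mx i j *m x - x *m delta_mx i j = 0.
Proof.
move=> xj xi; apply/matrixP=> a b; rewrite !mxE !big1 ?subr0 // => c _.
  by rewrite mxE; have [->|] := eqVneq c i; rewrite ?xi ?mul0r // mulr0.
by rewrite mxE andbC; have [->|] := eqVneq c j; rewrite ?xj ?mulr0 // mul0r.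
Qed.

Lemma richardsonE (K : closedFieldType) (n : nat) (d : seq nat)
    (i j : 'I_n.+1) :
  richardson K n d i j = (hline d i j)%:R.
Proof.
rewrite /richardson summxE (bigD1 i) //=.
rewrite [X in _ + X]big1 ?addr0 => [|k ki]; last first.
  by rewrite summxE big1 // => l _; rewrite mxE eq_sym (negPf ki).
rewrite summxE; case: (boolP (hline d i j)) => ij.
  rewrite (bigD1 j) //= mxE !eqxx big1 ?addr0 // => k /andP[_ kj].
  by rewrite mxE eqxx eq_sym (negPf kj).
rewrite big1 // => k ik; rewrite mxE eqxx; case: eqP => //= jk.
by rewrite jk ik in ij.
Qed.

(** In the first row a line joins exactly the dots of adjacent columns, since
every column reaches the first row; the second row has a single dot. *)
Lemma richardson_chain (K : closedFieldType) (n : nat) (d : seq nat)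
    (h : 'I_n.+1) :
    dim_vector n d -> (0 < h)%N ->
    levi_simple_roots n d = [fset simple_root n h]%fset ->
  richardson K n d = chain_shift K h 1.
Proof.
move=> dP h0 levi; have [ch rh cl rl] := dot_lift dP h0 levi.
have {dP} /andP[/allP d0 /eqP sd] := dP.
apply/matrixP=> i j; rewrite richardsonE /hline.
case: (unliftP h i) => [a|] ->; case: (unliftP h j) => [b|] ->;
  rewrite ?chain_shiftE ?chain_shift_row ?chain_shift_col ?rh ?rl ?ltnn //.
rewrite !cl eqxx addn1 /=; congr (_%:R); congr nat_of_bool.
apply/idP/eqP => [/andP[ab /allP gap]|->]; last first.
  by rewrite ltnSn /index_iota subnn.
apply/eqP; rewrite eqn_leq ab andbT leqNgt; apply/negP => ab1.
have ai : a.+1 \in index_iota a.+1 b by rewrite mem_index_iota leqnn.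
have := gap _ ai; rewrite leqNgt d0 // mem_nth // (ltn_trans ab1) //.
rewrite -(cl b); apply: reshape_indexP; rewrite sd; exact: ltn_ord.
Qed.

(** The two matrix units attach the isolated dot h to the beginning and to the
end of the chain; each of them centralizes x, and belongs to the nilradical
exactly when its condition on columns holds.  Stating this as a filter treats
the three positions of h at once. *)
Lemma centralizer_basis (K : closedFieldType) (n : nat) (d : seq nat)
    (h : 'I_n.+1) :
    dim_vector n d -> (0 < h)%N ->
    levi_simple_roots n d = [fset simple_root n h]%fset ->
  basis_of (lie_centralizer (nilradical K n d) (richardson K n d))
    ([seq delta_mx ij.1 ij.2 | ij : 'I_n.+1 * 'I_n.+1
                             <- [:: (ord0, h); (h, ord_max)]
                             & (dot_col d ij.1 < dot_col d ij.2)%N] ++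
     [seq richardson K n d ^+ k | k <- iota 1 n.-1]).
Proof.
move=> dP h0 levi.
have [ch rh cl rl] := dot_lift dP h0 levi.
have xE := richardson_chain K dP h0 levi; set x := richardson K n d in xE *.
have n0 : (0 < n)%N by have := ltn_ord h; lia.
pose a0 := Ordinal n0; have l0 : lift h a0 = ord0 by exact: lift_ord0.
set E := [seq ij <- _ | _].
have xkE k : (0 < k)%N -> x ^+ k = chain_shift K h k.
  by move=> k0; rewrite xE chain_shiftX.
pose f (t : 'I_n.+1 * 'I_n.+1 + nat) : 'M[K]_n.+1 :=
  match t with inl ij => delta_mx ij.1 ij.2 | inr k => x ^+ k end.
(* The first row of x ^ k has its only nonzero entry at chain position k. *)
pose g (t : 'I_n.+1 * 'I_n.+1 + nat) : 'I_n.+1 * 'I_n.+1 :=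
  match t with inl ij => ij | inr k => (ord0, lift h (insubd a0 k)) end.
have h_neq0 : (ord0 == h) = false by rewrite -val_eqE /= ltn_eqF.
have memE i j : ((i, j) \in E) =
    (dot_col d i < dot_col d j)%N &&
    ((i == ord0) && (j == h) || (i == h) && (j == ord_max)).
  by rewrite mem_filter !inE !xpair_eqE.
pose r := map (@inl _ nat) E ++ map inr (iota 1 n.-1).
have mem_inl ij : (inl ij \in r) = (ij \in E).
  rewrite mem_cat mem_map => [|u v [] //]; rewrite orbC.
  by case: mapP => [[]|].
have mem_inr k : (inr k \in r) = (0 < k < n)%N.
  rewrite mem_cat (mem_map (f := inr)) => [|u v [] //].
  rewrite mem_iota add1n prednK //.
  by case: mapP => [[]|].
have -> : [seq delta_mx ij.1 ij.2 | ij <- E] ++ [seq x ^+ k | k <- iota 1 n.-1]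
    = map f r by rewrite /r map_cat -!map_comp.
apply: (basis_of_pivots (g := g)).
- rewrite cat_uniq !map_inj_uniq ?iota_uniq ?andbT => [|u v []|u v []] //.
  rewrite filter_uniq /= ?inE ?xpair_eqE ?h_neq0 //.
  by apply/hasPn => _ /mapP[k _ ->]; apply/mapP => -[].
- case=> [[i j]|k]; rewrite ?mem_inl ?mem_inr ?memE => /andP[].
    move=> ij ijE; apply/mem_lie_centralizer; split.
      apply/mem_nilradical => a b ba; rewrite mxE.
      by case: eqP => // ai; case: eqP => // bj; rewrite ai bj leqNgt ij in ba.
    (* The column of x at the beginning of the chain and its row at the end of
       the chain are zero, as are its row and its column h. *)
    apply: delta_centralizes => a; rewrite xE.
      case/orP: ijE ij => /andP[/eqP-> /eqP->] ij; first exact: chain_shift_row.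
      case: (unliftP h ord_max) => [m|] mh; last by rewrite mh ltnn in ij.
      rewrite mh; case: (unliftP h a) => [b|] ->; last exact: chain_shift_col.
      rewrite chain_shiftE; case: eqP => // bm.
      have := congr1 val mh; rewrite /= /bump.
      have : (b < n)%N := ltn_ord b; rewrite bm.
      by case: (h <= m)%N => bn nm; exfalso; lia.
    case/orP: ijE ij => /andP[/eqP-> /eqP->] ij; last exact: chain_shift_col.
    case: (unliftP h a) => [b|] ->; last exact: chain_shift_row.
    by rewrite -l0 chain_shiftE addn1.
  move=> k0 kn; rewrite /f; apply/mem_lie_centralizer; split.
    apply/mem_nilradical => i j; rewrite xkE //.
    case: (unliftP h i) => [a|] -> ; last by rewrite chain_shift_row.
    case: (unliftP h j) => [b|] -> ; last by rewrite chain_shift_col.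
    by rewrite !cl chain_shiftE; case: eqP => // ->; lia.
  by rewrite /lie_bracket mulmxE -exprSr -exprS subrr.
- case=> [[i j]|k] [[i' j']|l]; rewrite ?mem_inl ?mem_inr /= => tr ur.
  + by rewrite mxE eq_sym (eq_sym j').
  + move: tr; rewrite mxE memE.
    case/andP => _ /orP[] /andP[/eqP-> /eqP->]; rewrite ?h_neq0 //.
    by rewrite eq_sym (negPf (neq_lift _ _)) andbF.
  + have /andP[k0 _] := tr; rewrite xkE //; move: ur; rewrite memE.
    case/andP => _ /orP[] /andP[/eqP-> /eqP->].
      exact: chain_shift_col.
    exact: chain_shift_row.
  + have /andP[k0 _] := tr; have /andP[_ ln] := ur.
    by rewrite xkE // -l0 chain_shiftE insubdK //= eq_sym.
- move=> z /mem_lie_centralizer[/mem_nilradical zu /subr0_eq zx] pivots.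
  have zE i j : (i, j) \in E -> z i j = 0.
    by rewrite -mem_inl => /pivots.
  apply: (commute_chain_shift_eq0 (h := h)); first by rewrite -xE.
  + move=> a j /(lift_ord0 h0) ->.
    case: (leqP (dot_col d j) (dot_col d (ord0 : 'I_n.+1))) => [|cj].
      exact: zu.
    case: (unliftP h j) cj => [b|] -> cj; last first.
      by rewrite zE // memE cj !eqxx.
    have b0 : (0 < b)%N by rewrite -(cl b) (leq_ltn_trans _ cj).
    have := pivots (inr (b : nat)); rewrite mem_inr b0 ltn_ord /= => /(_ isT).
    by rewrite valKd.
  + move=> a an.
    case: (leqP (dot_col d (lift h a)) (dot_col d h)) => [|ca].
      exact: zu.
    rewrite zE // memE ca eqxx orbC /=.
    rewrite -val_eqE /= /bump -[X in _ == X]an; move: ca; rewrite ch cl.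
    by case: leqP; lia.
  + exact: zu.
Qed.

Theorem theorem3p3 (K : closedFieldType) (p : nat) (charK : p \in [pchar K])
    (n : nat) (n_gt1 : (1 < n)%N) (d : seq nat) (dP : dim_vector n d)
    (card_levi : #|` levi_simple_roots n d| = 1%N) :
  [/\ levi_simple_roots n d = [fset simple_root n 1]%fset ->
        basis_of (lie_centralizer (nilradical K n d) (richardson K n d))
          (munit K n 2 n.+1
             :: [seq richardson K n d ^+ k | k <- iota 1 n.-1]),
      (forall s : nat, (1 < s < n)%N ->
        levi_simple_roots n d = [fset simple_root n s]%fset ->
        basis_of (lie_centralizer (nilradical K n d) (richardson K n d))
          [:: munit K n 1 s.+1, munit K n s.+1 n.+1
            & [seq richardson K n d ^+ k | k <- iota 1 n.-1]])
    & levi_simple_roots n d = [fset simple_root n n]%fset ->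
        basis_of (lie_centralizer (nilradical K n d) (richardson K n d))
          (munit K n 1 n.+1
             :: [seq richardson K n d ^+ k | k <- iota 1 n.-1])].
Proof.
have vlabel s : (s <= n)%N -> label n s.+1 = s :> nat.
  by move=> sn; rewrite inordK.
have first : label n 1 = ord0 by apply: val_inj; exact: vlabel.
have last : label n n.+1 = ord_max by apply: val_inj; exact: vlabel.
(* With columns counted from 0, dot s + 1 is in column s - 1 and the last column
   is n - 1: the first column is to its left iff 1 < s, the last one is to its
   right iff s < n. *)
have basis s : (0 < s <= n)%N ->
    levi_simple_roots n d = [fset simple_root n s]%fset ->
    basis_of (lie_centralizer (nilradical K n d) (richardson K n d))
      ([seq munit K n ij.1 ij.2
          | ij <- (if 1 < s then [:: (1, s.+1)] else [::]) ++
                  (if s < n then [:: (s.+1, n.+1)] else [::])]%N ++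
       [seq richardson K n d ^+ k | k <- iota 1 n.-1]).
  case/andP=> s0 sn; rewrite -{1}(vlabel _ sn) => levi.
  have h0 : (0 < label n s.+1)%N by rewrite vlabel.
  have := centralizer_basis K dP h0 levi.
  have [ch _ cl _] := dot_lift dP h0 levi.
  rewrite vlabel // in ch.
  have n0 : (0 < n)%N by exact: leq_trans sn.
  have c0 : dot_col d (ord0 : 'I_n.+1) = 0%N.
    by rewrite -(lift_ord0 (a := Ordinal n0) h0) // cl.
  have cm : (s.-1 < dot_col d (ord_max : 'I_n.+1))%N = (s < n)%N.
    case: (unliftP (label n s.+1) ord_max) => [a|] maxE.
      rewrite maxE cl; have := congr1 val maxE.
      by rewrite /= /bump vlabel //; have := ltn_ord a; lia.
    rewrite maxE vlabel // ch ltnn; have := congr1 val maxE.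
    by rewrite /= vlabel // => ->; rewrite ltnn.
  have c1 : (0 < s.-1)%N = (1 < s)%N by lia.
  rewrite /= vlabel // ch c0 cm c1.
  by case: (1 < s)%N; case: (s < n)%N; rewrite /= /munit ?first ?last.
split=> [levi|s /andP[s1 sn] levi|levi].
- by move: (basis 1%N); rewrite ltnn n_gt1 (ltnW n_gt1) => /(_ isT levi).
- by move: (basis s); rewrite s1 sn (ltnW s1) (ltnW sn) => /(_ isT levi).
- by move: (basis n); rewrite ltnn n_gt1 (ltnW n_gt1) leqnn => /(_ isT levi).
Qed.
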